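(* Let $B$ be a real $2\times 2$ matrix which is diagonalizable over $\mathbb{R}$ and satisfies $\operatorname{trace} B=0$. Then the union of totally real planes $M(B)=\mathbb{R}^2\cup A(B)\subset\mathbb{C}^2$ has a regular Stein neighborhood basis in $\mathbb{C}^2$, i.e. a regular basis $\{\Omega_\epsilon\}_{\epsilon\in(0,1)}$ of open neighborhoods of $M(B)$ all of whose members $\Omega_\epsilon$ are Stein.
   Context: For a real $2\times2$ matrix $B$ with $B-iI$ invertible, $A(B)\subset\mathbb{C}^2$ denotes the real linear span of the columns of the matrix $B+iI$, and $M(B):=\mathbb{R}^2\cup A(B)$. A system $\{\Omega_\epsilon,\ \epsilon\in(0,1)\}$ of open neighborhoods of a subset $K$ of a manifold $M$ is called a regular basis if for every $\epsilon\in(0,1)$: (1) $\Omega_\epsilon=\bigcup_{s<\epsilon}\Omega_s$; (2) $\overline{\Omega}_\epsilon=\bigcap_{s>\epsilon}\Omega_s$; (3) $K=\bigcap_{s>0}\Omega_s$ is a strong deformation retract of $\Omega_\epsilon$. *)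

(* Defs.v *)
From HB Require Import structures.
From mathcomp Require Import all_boot all_order all_algebra.
From mathcomp Require Import complex.
From mathcomp Require Import all_classical all_reals all_analysis.

Set Implicit Arguments.
Unset Strict Implicit.
Unset Printing Implicit Defensive.

Import Order.TTheory GRing.Theory Num.Theory.
Import numFieldNormedType.Exports.

Local Open Scope classical_set_scope.
Local Open Scope ring_scope.
Local Open Scope complex_scope.

(* R[i] inherits its topology and norm from its regular module structure, as
   numFieldNormedType.Exports does for an abstract numFieldType. *)
HB.instance Definition _ (R : realType) := NormedModule.copy R[i] R[i]^o.

Section RegularBasis.
Context {R : realType} {T : topologicalType}.
Implicit Types (K U : set T) (Omega : R -> set T).

(* The homotopy H is a total function; only its values on U x [0, 1] are
   constrained, and its continuity is for the subspace topology there. *)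
Definition strong_deformation_retract K U : Prop :=
  K `<=` U /\
  exists H : T * R -> T,
    [/\ {within U `*` `[0, 1], continuous H},
        forall x t, U x -> t \in `[0, 1] -> U (H (x, t)),
        forall x, U x -> H (x, 0) = x,
        forall x, U x -> K (H (x, 1)) &
        forall x t, K x -> t \in `[0, 1] -> H (x, t) = x].

(* Only the members with index in ]0, 1[ belong to the system, so the unions
   and intersections below range over indices of that interval. *)
Definition regular_basis K Omega : Prop :=
  forall e, 0 < e < 1 ->
    [/\ open (Omega e) /\ K `<=` Omega e,
        Omega e = \bigcup_(s in `]0, e[) Omega s,
        closure (Omega e) = \bigcap_(s in `]e, 1[) Omega s,
        K = \bigcap_(s in `]0, 1[) Omega s &
        strong_deformation_retract K (Omega e)].

End RegularBasis.

Section Stein.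
Context {R : realType} {n : nat}.
Local Notation Cn := 'cV[R[i]]_n.+1.
Implicit Types (D K : set Cn) (f : Cn -> R[i]).

(* differentiable is over the scalar field R[i], i.e. complex (Frechet)
   differentiability; for D open it only depends on the values of f on D. *)
Definition holomorphic_on D f : Prop :=
  forall z, D z -> differentiable f z.

(* Re turns the R[i]-valued modulus into an element of R. For K compact in D,
   the supremum is that of a bounded set; it is 0 if K is empty, in which case
   the function 1 shows that the hull is empty. *)
Definition holomorphic_hull D K : set Cn :=
  [set z | D z /\ forall f, holomorphic_on D f ->
     complex.Re `|f z| <= sup [set complex.Re `|f w| | w in K]].

Definition holomorphically_convex D : Prop :=
  forall K, compact K -> K `<=` D -> compact (holomorphic_hull D K).

Definition holomorphically_separable D : Prop :=
  forall z w, D z -> D w -> z <> w ->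
    exists2 f, holomorphic_on D f & f z <> f w.

(* Near each point, n.+1 global holomorphic functions are local coordinates,
   i.e. their differentials at the point are linearly independent. *)
Definition global_local_coordinates D : Prop :=
  forall z, D z ->
    exists2 F : 'I_n.+1 -> Cn -> R[i],
      forall j, holomorphic_on D (F j) &
      forall v : Cn, (forall j, 'd (F j) z v = 0) -> v = 0.

(* Definition of a Stein manifold, for an open submanifold of C^n. *)
Definition stein D : Prop :=
  [/\ open D, holomorphically_convex D, holomorphically_separable D &
      global_local_coordinates D].

End Stein.

Section Planes.
Context {R : realType}.

Definition real_plane : set 'cV[R[i]]_2 :=
  range (fun x : 'cV[R]_2 => map_mx (real_complex R) x).

Definition A_plane (B : 'M[R]_2) : set 'cV[R[i]]_2 :=
  range (fun c : 'I_2 -> R =>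
    \sum_j (c j)%:C *: col j (map_mx (real_complex R) B + ('i%C)%:M)).

Definition M_union (B : 'M[R]_2) : set 'cV[R[i]]_2 :=
  real_plane `|` A_plane B.

End Planes.

(* Main.v *)
(* After a real linear change of coordinates w = P z we have B = diag(a, -a).
   Put v = Im z and u = Re z - B v, so that the two planes are {v = 0} and
   {u = 0}; let U, V be the images of u, v under P. The neighborhoods are
   {rho < e}, where
     rho = max(|U_0 V_0|, |U_1 V_1|, |U_0 V_1 + U_1 V_0|).
   Each U_j V_j depends on w_j only, and U_0 V_1 + U_1 V_0 = Im (w_0 w_1): the
   terms in V_0 V_1 cancel because B has trace 0. So through each point outside
   {rho < e} passes a complex curve {w_j = c} or {w_0 w_1 = c} which avoids
   {rho < e}, whence this set is Stein. As rho is multiplied by |a b| when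
   (u, v) is replaced by (a u, b v), one retracts {rho < e} by shrinking the
   shorter of u and v to 0 and the longer one correspondingly. *)
From HB Require Import structures.
Require Import Defs.
From mathcomp Require Import all_boot all_order all_algebra.
From mathcomp Require Import complex.
From mathcomp Require Import ring lra.
From mathcomp Require Import all_classical all_reals all_analysis.
Import Order.TTheory GRing.Theory Num.Theory.
Import numFieldNormedType.Exports.
Local Open Scope classical_set_scope.
Local Open Scope ring_scope.
Local Open Scope complex_scope.

(** * Modulus and continuity over [R[i]] *)

Lemma Re_norm_ge0 (R : realType) (x : R[i]) : 0 <= complex.Re `|x|.
Proof. by rewrite normc_def /= sqrtr_ge0. Qed.

Lemma normc_Re (R : realType) (x : R[i]) : `|x| = (complex.Re `|x|)%:C.
Proof. by rewrite normc_def. Qed.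

Lemma Re_normM (R : realType) (x y : R[i]) :
  complex.Re `|x * y| = complex.Re `|x| * complex.Re `|y|.
Proof. by rewrite normrM [`|x|]normc_Re [`|y|]normc_Re -rmorphM. Qed.

Lemma norm_Re_le (R : realType) (x : R[i]) : `|complex.Re x| <= complex.Re `|x|.
Proof. by rewrite normc_def /= -sqrtr_sqr ler_wsqrtr // lerDl sqr_ge0. Qed.

Lemma norm_Im_le (R : realType) (x : R[i]) : `|complex.Im x| <= complex.Re `|x|.
Proof. by rewrite normc_def /= -sqrtr_sqr ler_wsqrtr // lerDr sqr_ge0. Qed.

Lemma continuous_Re (R : realType) : continuous (@complex.Re R).
Proof.
move=> z; apply/(@cvgrPdist_lt _ _ _ (nbhs z)) => e e0; apply/nbhs_normP.
exists e%:C => /=; first by rewrite ltcR.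
move=> w; rewrite /= normc_Re ltcR; apply: le_lt_trans.
by rewrite -raddfB norm_Re_le.
Qed.

Lemma continuous_Im (R : realType) : continuous (@complex.Im R).
Proof.
move=> z; apply/(@cvgrPdist_lt _ _ _ (nbhs z)) => e e0; apply/nbhs_normP.
exists e%:C => /=; first by rewrite ltcR.
move=> w; rewrite /= normc_Re ltcR; apply: le_lt_trans.
by rewrite -raddfB norm_Im_le.
Qed.

Lemma continuous_real_complex (R : realType) :
  continuous (real_complex R : R -> R[i]).
Proof.
move=> x; apply/(@cvgrPdist_lt _ _ _ (nbhs x)) => e e0.
(* The radius [e] lives in [R[i]]; being positive, it has zero imaginary part. *)
have eE : e = (complex.Re e)%:C.
  by move: e0; case: (e) => a b; rewrite ltcE /= => /andP[/eqP -> _].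
have e1 : 0 < complex.Re e by rewrite -ltcR -eE.
apply/nbhs_normP; exists (complex.Re e) => //= y.
by rewrite -rmorphB normc_def /= expr0n addr0 sqrtr_sqr {2}eE ltcR.
Qed.

Lemma continuous_Complex (R : realType) (T : topologicalType) (f g : T -> R)
    (x : T) :
  {for x, continuous f} -> {for x, continuous g} ->
  {for x, continuous (fun t => (f t +i* g t) : R[i])}.
Proof.
move=> cf cg.
have -> : (fun t => (f t +i* g t) : R[i]) =
    (fun t => (f t)%:C + 'i%C * (g t)%:C).
  by apply/funext => t; rewrite [LHS]complexE.
apply: cvgD.
  exact: (continuous_comp cf (@continuous_real_complex _ _)).
apply: cvgM; first exact: cvg_cst.
exact: (continuous_comp cg (@continuous_real_complex _ _)).
Qed.

Lemma continuous_matrix (T S : topologicalType) m n (f : T -> 'M[S]_(m, n)) x :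
  (forall i j, {for x, continuous (fun t => f t i j)}) -> {for x, continuous f}.
Proof.
move=> cf A [P PA sPA]; rewrite nbhs_simpl /=.
have Q i j : nbhs x [set t | P i j (f t i j)] by exact: cf.
have : \forall t \near x, forall i j, P i j (f t i j).
  by apply: filter_forall => i; apply: filter_forall => j; exact: Q.
by apply: filterS => t; exact: sPA.
Qed.

(** * Compactness in C^n *)

Lemma compact_disc (R : realType) (M : R) :
  exists2 D : set R[i],
    compact D & [set x : R[i] | complex.Re `|x| <= M] `<=` D.
Proof.
pose f (p : R * R) : R[i] := p.1 +i* p.2.
exists (f @` (`[(- M), M] `*` `[(- M), M])).
  apply: continuous_compact; last first.
    by apply: compact_setX; exact: segment_compact.
  apply: continuous_subspaceT => p.
  by apply: continuous_Complex; [exact: cvg_fst|exact: cvg_snd].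
move=> x /= xM; exists (complex.Re x, complex.Im x); last by case: x xM.
by split; rewrite /= in_itv /= -ler_norml (le_trans _ xM) // ?norm_Re_le
  ?norm_Im_le.
Qed.

(** A product of compact sets is compact as a set of rows, and the continuous transposition carries
    it to columns. *)
Lemma closed_bounded_compact (R : realType) n (A : set 'cV[R[i]]_n) (M : R) :
  closed A -> (forall z i, A z -> complex.Re `|z i 0| <= M) -> compact A.
Proof.
move=> Acl AM; have [D Dco DM] := compact_disc R M.
have Tc : continuous (fun v : 'rV[R[i]]_n => v^T).
  move=> v; apply: continuous_matrix => i j.
  have -> : (fun t : 'rV[R[i]]_n => t^T i j) = (fun t => t j i).
    by apply/funext => t; rewrite mxE.
  exact: coord_continuous.
apply: (subclosed_compact Acl).
  apply: (continuous_compact (continuous_subspaceT Tc)).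
  exact: (@rV_compact _ _ (fun=> D)).
move=> z Az; exists z^T; last by rewrite trmxK.
by move=> i; rewrite mxE; apply: DM; exact: AM.
Qed.

(** * A criterion for Stein open sets *)

(* The inverse 1/q of the function attached to a point p outside D is
   holomorphic on D; being bounded on the hull of K, it keeps p out of the
   closure of this hull. *)
Lemma stein_of_avoiding (R : realType) n (D : set 'cV[R[i]]_n.+1) :
  open D ->
  (forall p, ~ D p -> exists q : 'cV[R[i]]_n.+1 -> R[i],
     [/\ holomorphic_on setT q, q p = 0 & forall w, D w -> q w <> 0]) ->
  stein D.
Proof.
move=> oD avoid.
have hol_coord i : holomorphic_on D (fun z : 'cV[R[i]]_n.+1 => z i 0).
  by move=> z _; exact: differentiable_coord.
have cRn : continuous (fun x : R[i] => complex.Re `|x|).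
  move=> x; apply: (continuous_comp (@norm_continuous _ _ x)).
  exact: continuous_Re.
split => //.
- move=> K _ _.
  pose c (f : 'cV[R[i]]_n.+1 -> R[i]) := sup [set complex.Re `|f w| | w in K].
  (* The coordinates are holomorphic on [D], so on the hull each is bounded by its supremum over
     [K]; [M] dominates these suprema. *)
  pose M := \big[Num.max/0]_(i < n.+1) c (fun z : 'cV[R[i]]_n.+1 => z i 0).
  have hullcl : closed (holomorphic_hull D K).
    move=> p clp.
    have closed_le_at (g : 'cV[R[i]]_n.+1 -> R) (a : R) :
        {for p, continuous g} ->
        (forall w, holomorphic_hull D K w -> g w <= a) -> g p <= a.
      move=> cg ga; rewrite leNgt; apply/negP => agp.
      have /clp[w [/ga gwa /= agw]] : nbhs p [set w | a < g w].
        exact: (cvgr_gt _ cg).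
      by move: agw; rewrite ltNge gwa.
    have Dp : D p.
      apply: contrapT => /avoid[q [hq qp0 qD]].
      have hV : holomorphic_on D (fun z => (q z)^-1).
        by move=> z Dz; apply: differentiableV; [exact: hq|exact/eqP/qD].
      (* [closed_le_at] transports upper bounds only, so the lower bound 1 for [c * |q w|] on the
         hull is negated; at [p], where [q] vanishes, it reads 0 <= -1. *)
      have : - (c (fun z => (q z)^-1) * complex.Re `|q p|) <= -1.
        apply: (closed_le_at
          (fun w => - (c (fun z => (q z)^-1) * complex.Re `|q w|))).
          apply: continuousN; apply: continuousM; first exact: cst_continuous.
          apply: (@continuous_comp _ _ _ q (fun x => complex.Re `|x|));
            last exact: cRn.
          by apply: differentiable_continuous; exact: hq.
        move=> w [Dw /(_ _ hV)] hw; rewrite lerN2.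
        have q0 : q w != 0 by exact/eqP/qD.
        have <- : complex.Re `|(q w)^-1| * complex.Re `|q w| = 1.
          by rewrite -Re_normM mulVf // normr1.
        by rewrite ler_wpM2r // Re_norm_ge0.
      by rewrite qp0 normr0 mulr0 oppr0 lerNr oppr0 ler10.
    split => // f hf; apply: (closed_le_at (fun w => complex.Re `|f w|)).
      apply: (@continuous_comp _ _ _ f (fun x => complex.Re `|x|));
        last exact: cRn.
      by apply: differentiable_continuous; exact: hf.
    by move=> w [_]; exact.
  apply: (closed_bounded_compact R _ _ M hullcl) => z i [_ /(_ _ (hol_coord i)) hz].
  apply: le_trans hz _.
  exact: (le_bigmax _ (fun i => c (fun z : 'cV[R[i]]_n.+1 => z i 0)) i).
- move=> z w Dz Dw zw; have [i zwi] : exists i, z i 0 <> w i 0.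
    apply/existsNP => zw'; apply: zw; apply/matrixP => i j.
    by rewrite ord1; exact: zw'.
  by exists (fun z => z i 0).
- move=> z Dz; exists (fun i (z : 'cV[R[i]]_n.+1) => z i 0) => // v dv.
  apply/matrixP => i j; rewrite ord1 mxE -(dv i).
  (* A continuous linear map is its own differential. *)
  pose coord (z : 'cV[R[i]]_n.+1) : R[i] := z i 0.
  have coord_lin : linear coord by move=> a x y; rewrite /coord !mxE.
  pose coordM := GRing.isLinear.Build _ _ _ _ _ coord_lin.
  pose coordL : {linear 'cV[R[i]]_n.+1 -> R[i]} := 
    HB.pack coord coordM.
  by rewrite (@diff_lin _ _ _ coordL) //; exact: coord_continuous.
Qed.

(** * Regular bases from sublevel sets *)

(** The decay of [rho] along [H] serves twice: at t = 1 it lands in the zero set, and for small t >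
    0 it pushes points of the level set {rho = e} into {rho < e}, so that the closure is all of {rho
    <= e}. *)
Lemma regular_basis_sublevel (R : realType) (T : topologicalType)
    (rho : T -> R) (H : T * R -> T) :
  continuous rho -> continuous H -> (forall z, 0 <= rho z) ->
  (forall z, H (z, 0) = z) ->
  (forall z t, t \in `[0, 1] -> rho (H (z, t)) <= (1 - t) * rho z) ->
  (forall z t, t \in `[0, 1] -> rho z = 0 -> H (z, t) = z) ->
  regular_basis [set z | rho z = 0] (fun e : R => [set z | rho z < e]).
Proof.
move=> crho cH rho0 H0 Hrho Hfix e /andP[e0 e1].
have open_sublevel (a : R) : open [set z | rho z < a].
  by apply: (open_comp (f := rho)) (open_lt (y := a)) => z _; exact: crho.
have closed_sublevel (a : R) : closed [set z | rho z <= a].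
  by apply: (closed_comp (f := rho)) (closed_le (y := a)) => z _; exact: crho.
split.
- by split=> // z /= ->.
- apply/seteqP; split=> [z /= ze|z [s /=]]; last first.
    by rewrite in_itv /= => /andP[_ se] /lt_trans; exact.
  exists ((rho z + e) / 2) => /=; last by rewrite midf_lt.
  by rewrite in_itv /= midf_lt // andbT divr_gt0 // ltr_wpDl.
- apply/seteqP; split=> [z clz s /=|z zs].
    rewrite in_itv /= => /andP[es _]; apply: le_lt_trans es.
    have sub : [set z | rho z < e] `<=` [set z | rho z <= e] by move=> w /ltW.
    by have := closureS sub clz; rewrite -(proj1 (closure_id _) (closed_sublevel e)).
  have ze : rho z <= e.
    rewrite leNgt; apply/negP => ez.
    (* An index in ]e, 1[ that is at most [rho z]; the midpoint keeps it below 1 when [rho z] is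
       large. *)
    have := zs (Num.min (rho z) ((e + 1) / 2)).
    rewrite /= in_itv /= lt_min ez midf_lt //= gt_min midf_lt // orbT.
    move=> /(_ isT).
    by rewrite lt_min ltxx.
  (* [z] is the limit of [H (z, t)] as t decreases to 0, and there [rho] is at most (1 - t) e <
     e. *)
  move=> A zA.
  have cHz : {for 0, continuous (fun t : R => H (z, t))}.
    apply: (continuous_comp (f := fun t : R => (z, t))); last exact: cH.
    move=> B [[P Q] /= [Pz Q0] sub]; rewrite nbhs_simpl /=.
    apply: filterS Q0 => t Qt; apply: sub; split => //=.
    exact: nbhs_singleton Pz.
  have : \forall t \near (0:R)^'+, A (H (z, t)).
    by apply: cvg_at_right_filter cHz _ _; rewrite H0.
  move=> nA.
  have [t [[tA t0] t1]] : exists t : R, (A (H (z, t)) /\ 0 < t) /\ t < 1.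
    near (0:R)^'+ => t; exists t; split; last by near: t; exact: nbhs_right_lt.
    by split; near: t => //; exact: nbhs_right_gt.
  exists (H (z, t)); split=> //=.
  have tI : t \in `[0, 1] by rewrite in_itv /= !ltW.
  apply: le_lt_trans (Hrho _ _ tI) _; apply: le_lt_trans (ler_wpM2l _ ze) _.
    by rewrite subr_ge0 ltW.
  by rewrite gtr_pMl // gtrBl.
- apply/seteqP; split=> [z /= z0 s /=|z zs].
    by rewrite in_itv z0 /= => /andP[].
  apply/eqP; rewrite eq_le rho0 andbT leNgt; apply/negP => z0 /=.
  have := zs (Num.min (rho z) (1 / 2)).
  rewrite /= in_itv /= lt_min z0 divr_gt0 //= gt_min.
  rewrite (_ : 1 / 2 < 1) ?orbT; last by lra.
  by move=> /(_ isT); rewrite lt_min ltxx.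
- split; first by move=> z /= ->.
  exists H; split=> //.
  + exact: continuous_subspaceT.
  + move=> z t /= ze tI; apply: le_lt_trans (Hrho _ _ tI) _.
    apply: le_lt_trans ze; rewrite ler_piMl //.
    by move: tI; rewrite in_itv /= => /andP[t0 _]; rewrite gerBl.
  + move=> z _ /=; apply/eqP; rewrite eq_le rho0 andbT.
    apply: le_trans (Hrho _ _ _) _; rewrite ?subrr ?mul0r //.
    by rewrite in_itv /= ler01 lexx.
  + by move=> z t z0 tI; exact: Hfix.
Unshelve. all: by end_near. Qed.

(** * Continuity of damped vectors *)

(** At a zero of [f] the bound on [k] alone forces the product to tend to 0. This admits factors
    such as min(1, |v| / |u|), which jump where u = 0 and v is nonzero. *)
Lemma continuous_scale_bounded (R : realType) (V : normedModType R)
    (T : topologicalType) (k : T -> R) (f : T -> V) :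
  continuous f -> (forall p, `|k p| <= 1) ->
  (forall p, f p != 0 -> {for p, continuous k}) ->
  continuous (fun p => k p *: f p).
Proof.
move=> cf k1 ck p; have [fp0|fp0] := eqVneq (f p) 0; last first.
  by apply: cvgZ; [exact: ck|exact: cf].
rewrite /continuous_at fp0 scaler0; apply/cvgrPdist_lt => e e0.
have : \forall q \near p, `|f p - f q| < e.
  by move: e e0; apply/cvgrPdist_lt; exact: cf.
apply: filterS => q; rewrite fp0 !sub0r !normrN normrZ; apply: le_lt_trans.
by rewrite ler_piMl.
Qed.

Lemma continuous_min1_ratio (R : realType) (T : topologicalType)
    (f g : T -> R) p :
  {for p, continuous f} -> {for p, continuous g} -> g p != 0 ->
  {for p, continuous (fun q => Num.min 1 (f q / g q))}.
Proof.
move=> cf cg gp; apply: continuous_min; first exact: cst_continuous.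
by apply: continuousM => //; exact: continuousV.
Qed.

Lemma min1_ratio_norm_le1 (R : realType) (a b : R) :
  0 <= a -> 0 <= b -> `|Num.min 1 (a / b)| <= 1.
Proof.
move=> a0 b0; rewrite ger0_norm ?ge_min ?lexx //.
by rewrite le_min ler01 divr_ge0.
Qed.

Lemma mulmx2E (S : pzSemiRingType) m n (A : 'M[S]_(m, 2)) (C : 'M[S]_(2, n))
    i j :
  (A *m C) i j = A i 0 * C 0 j + A i 1 * C 1 j.
Proof.
rewrite mxE !big_ord_recl big_ord0 addr0 (_ : lift _ _ = 1) //.
exact: val_inj.
Qed.

Lemma ord2_cases (i : 'I_2) : i = 0 \/ i = 1.
Proof. by case: i => -[|[]] // k; [left|right]; exact: val_inj. Qed.

(** * The function rho as a function of two real vectors *)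

Section Cross.
Context {R : realType}.
Implicit Types U V : 'cV[R]_2.

(** The largest absolute value of a coefficient of the polynomial (U_0 + U_1 X)(V_0 + V_1 X). *)
Definition cross U V : R :=
  Num.max `|U 0 0 * V 0 0|
    (Num.max `|U 1 0 * V 1 0| `|U 0 0 * V 1 0 + U 1 0 * V 0 0|).

Lemma cross_ge0 U V : 0 <= cross U V.
Proof. by rewrite /cross le_max normr_ge0. Qed.

Lemma crossZ a b U V : cross (a *: U) (b *: V) = `|a * b| * cross U V.
Proof.
by rewrite /cross !mxE !(mulrACA a _ b) -mulrDr !(normrM (a * b)) -!maxr_pMr.
Qed.

(** A product of two real polynomials vanishes only if a factor does; for degree at most 1 this is a
    short case analysis on U_0 and U_1. *)
Lemma cross_eq0 U V : cross U V = 0 -> U = 0 \/ V = 0.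
Proof.
move=> UV; have : cross U V <= 0 by rewrite UV.
rewrite /cross !ge_max !normr_le0 !mulf_eq0 => /and3P[].
have ext (W : 'cV[R]_2) : W 0 0 = 0 -> W 1 0 = 0 -> W = 0.
  move=> W0 W1; apply/matrixP => i j; rewrite ord1 mxE.
  by case: (ord2_cases i) => ->.
have [U0|U0] /= := eqVneq (U 0 0) 0; last first.
  move=> /eqP V0; rewrite V0 mulr0 addr0 => _; rewrite mulf_eq0 (negPf U0) /=.
  by move=> /eqP V1; right; exact: ext.
rewrite U0 mul0r add0r mulf_eq0 => _.
have [U1|U1] /= := eqVneq (U 1 0) 0; first by move=> _ _; left; exact: ext.
by move=> /eqP V1 /eqP V0; right; exact: ext.
Qed.

Lemma cross0v V : cross 0 V = 0.
Proof.
by have := crossZ 0 1 0 V; rewrite scale0r scale1r mul0r normr0 mul0r.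
Qed.

Lemma crossv0 U : cross U 0 = 0.
Proof.
by have := crossZ 1 0 U 0; rewrite scale0r scale1r mulr0 normr0 mul0r.
Qed.

Lemma continuous_cross (T : topologicalType) (f g : T -> 'cV[R]_2) :
  continuous f -> continuous g -> continuous (fun x => cross (f x) (g x)).
Proof.
move=> cf cg x.
have cM i j : {for x, continuous (fun y => f y i 0 * g y j 0)}.
  apply: continuousM.
    exact: (continuous_comp (cf x) (@coord_continuous _ _ _ i 0 _)).
  exact: (continuous_comp (cg x) (@coord_continuous _ _ _ j 0 _)).
have cN (h : T -> R) : {for x, continuous h} ->
    {for x, continuous (fun y => `|h y|)}.
  by move=> ch; exact: (continuous_comp ch (@norm_continuous _ _ _)).
have cmax (h k : T -> R) : {for x, continuous h} -> {for x, continuous k} ->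
    {for x, continuous (fun y => Num.max (h y) (k y))}.
  by move=> ch ck; exact: (continuous_max ch ck).
apply: (cmax); first exact: cN.
apply: (cmax); first exact: cN.
by apply: cN; apply: continuousD; exact: cM.
Qed.

End Cross.

(** * Real linear coordinates adapted to the two planes *)

Section RealCoordinates.
Context {R : realType}.
Implicit Types (B P : 'M[R]_2) (z : 'cV[R[i]]_2) (u v : 'cV[R]_2).

Definition re_mx z : 'cV[R]_2 := map_mx (@complex.Re R) z.
Definition im_mx z : 'cV[R]_2 := map_mx (@complex.Im R) z.
Definition transverse B z : 'cV[R]_2 := re_mx z - B *m im_mx z.
(** The inverse of the real coordinate system z -> (u, v), from z = (u + B v) + i v. *)
Definition of_transverse B u v : 'cV[R[i]]_2 :=
  \matrix_(i, j) ((u + B *m v) i j +i* v i j).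

Lemma im_of_transverse B u v : im_mx (of_transverse B u v) = v.
Proof. by apply/matrixP => i j; rewrite !mxE. Qed.

Lemma transverse_of_transverse B u v : transverse B (of_transverse B u v) = u.
Proof.
rewrite /transverse im_of_transverse; apply/eqP; rewrite subr_eq; apply/eqP.
by apply/matrixP => i j; rewrite !mxE.
Qed.

Lemma of_transverseK B z : of_transverse B (transverse B z) (im_mx z) = z.
Proof.
apply/matrixP => i j; rewrite mxE /transverse subrK !mxE.
by case: (z i j).
Qed.

Lemma continuous_mulmx B : continuous (fun v => B *m v).
Proof.
move=> v; apply: continuous_matrix => i j.
have -> : (fun t : 'cV[R]_2 => (B *m t) i j) =
    (fun t => B i 0 * t 0 j + B i 1 * t 1 j).
  by apply/funext => t; rewrite mulmx2E.
by apply: continuousD; apply: continuousM;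
  do [exact: cst_continuous|exact: coord_continuous].
Qed.

Lemma continuous_re_mx : continuous re_mx.
Proof.
move=> z; apply: continuous_matrix => i j.
have -> : (fun t => re_mx t i j) =
    @complex.Re R \o (fun t : 'cV[R[i]]_2 => t i j).
  by apply/funext => t; rewrite mxE.
by apply: continuous_comp; [exact: coord_continuous|exact: continuous_Re].
Qed.

Lemma continuous_im_mx : continuous im_mx.
Proof.
move=> z; apply: continuous_matrix => i j.
have -> : (fun t => im_mx t i j) =
    @complex.Im R \o (fun t : 'cV[R[i]]_2 => t i j).
  by apply/funext => t; rewrite mxE.
by apply: continuous_comp; [exact: coord_continuous|exact: continuous_Im].
Qed.

Lemma continuous_transverse B : continuous (transverse B).
Proof.
move=> z; apply: continuousB; first exact: continuous_re_mx.
exact: (continuous_comp (@continuous_im_mx z) (@continuous_mulmx B _)).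
Qed.

Lemma continuous_of_transverse (T : topologicalType) B (f g : T -> 'cV[R]_2) :
  continuous f -> continuous g ->
  continuous (fun x => of_transverse B (f x) (g x)).
Proof.
move=> cf cg x; apply: continuous_matrix => i j.
have -> : (fun t => of_transverse B (f t) (g t) i j) =
    (fun t => (f t + B *m g t) i j +i* g t i j).
  by apply/funext => t; rewrite mxE.
have cfg : {for x, continuous (fun t => f t + B *m g t)}.
  apply: continuousD; first exact: cf.
  exact: (continuous_comp (cg x) (@continuous_mulmx B _)).
apply: continuous_Complex.
  exact: (continuous_comp cfg (@coord_continuous _ _ _ i j _)).
exact: (continuous_comp (cg x) (@coord_continuous _ _ _ i j _)).
Qed.

Lemma real_planeE z : real_plane z <-> im_mx z = 0.
Proof.
split=> [[x _ <-]|z0]; first by apply/matrixP => i j; rewrite !mxE.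
exists (re_mx z) => //; apply/matrixP => i j; rewrite !mxE.
move/matrixP/(_ i j): z0; rewrite !mxE.
by case: (z i j) => a b /= ->.
Qed.

(** The vector (B + iI) c has real part B c and imaginary part c, so it is the point with u = 0 and
    v = c. *)
Lemma A_planeE B z : A_plane B z <-> transverse B z = 0.
Proof.
have E (c : 'I_2 -> R) :
    \sum_j (c j)%:C *: col j (map_mx (real_complex R) B + ('i%C)%:M) =
    of_transverse B 0 (\col_j c j).
  apply/matrixP => i j; rewrite ord1 summxE !big_ord_recl big_ord0 addr0.
  rewrite (_ : lift _ _ = 1); last exact: val_inj.
  rewrite [RHS]mxE add0r mulmx2E !mxE -[ord0]/(0 : 'I_2).
  have [->|->] := ord2_cases i.
    by apply/eqP; rewrite eq_complex /=; apply/andP; split; apply/eqP; ring.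
  by apply/eqP; rewrite eq_complex /=; apply/andP; split; apply/eqP; ring.
split=> [[c _ <-]|z0]; first by rewrite E transverse_of_transverse.
exists (fun j => im_mx z j 0) => //; rewrite E -{2}(of_transverseK B z) z0.
by congr (of_transverse B 0 _); apply/matrixP => i j; rewrite !mxE ord1.
Qed.

End RealCoordinates.

(** Both components of the retraction have this form. Continuity is asked of the product
    [k z *: f z] because [k] may jump at zeros of [f]. *)
Lemma continuous_damped (R : realType) (V : normedModType R)
    (T : topologicalType) (k : T -> R) (f : T -> V) :
  continuous f -> continuous (fun z => k z *: f z) ->
  continuous (fun q : T * R => f q.1 - q.2 *: (k q.1 *: f q.1)).
Proof.
move=> cf ckf q.
have c1 (g : T -> V) : continuous g ->
    {for q, continuous (fun p : T * R => g p.1)}.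
  by move=> cg; apply: (continuous_comp _ (cg q.1)); exact: cvg_fst.
have c2 : {for q, continuous (fun p : T * R => p.2 *: (k p.1 *: f p.1))}.
  by apply: continuousZ; [exact: cvg_snd|exact: (c1 _ ckf)].
exact: (continuousB (c1 f cf) c2).
Qed.

(** * The defining function and the retraction onto its zero set *)

Section Defining.
Context {R : realType} (B P : 'M[R]_2).
Implicit Types (z p : 'cV[R[i]]_2).

Definition defining z : R := cross (P *m transverse B z) (P *m im_mx z).

Lemma defining_ge0 z : 0 <= defining z.
Proof. exact: cross_ge0. Qed.

Lemma continuous_defining : continuous defining.
Proof.
apply: continuous_cross => z.
  exact: (continuous_comp (@continuous_transverse _ B z)
    (@continuous_mulmx _ P _)).
exact: (continuous_comp (@continuous_im_mx _ z) (@continuous_mulmx _ P _)).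
Qed.

Lemma defining_eq0 z : P \in unitmx ->
  defining z = 0 <-> transverse B z = 0 \/ im_mx z = 0.
Proof.
move=> Pu; split=> [/cross_eq0|[]]; rewrite /defining.
- have inj0 (w : 'cV[R]_2) : P *m w = 0 -> w = 0.
    by move=> Pw; rewrite -(mulKmx Pu w) Pw mulmx0.
  by case=> /inj0; [left|right].
- by move=> ->; rewrite mulmx0 cross0v.
- by move=> ->; rewrite mulmx0 crossv0.
Qed.

Lemma M_unionE : P \in unitmx -> M_union B = [set z | defining z = 0].
Proof.
move=> Pu; apply/seteqP; split=> z /=.
  by case=> [/real_planeE z0|/A_planeE z0]; apply/defining_eq0 => //;
    [right|left].
move/defining_eq0 => /(_ Pu)[z0|z0]; first by right; apply/A_planeE.
by left; apply/real_planeE.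
Qed.

(* Both quotients are 0 if their denominator vanishes. *)
Definition transverse_damping z : R :=
  Num.min 1 (`|im_mx z| / `|transverse B z|).
Definition im_damping z : R := Num.min 1 (`|transverse B z| / `|im_mx z|).

(** For t in [0, 1] both |u| and |v| decrease by the same amount t min(|u|, |v|), so the formula is
    symmetric in u and v and needs no case distinction at |u| = |v|. *)
Definition retraction (q : 'cV[R[i]]_2 * R) : 'cV[R[i]]_2 :=
  of_transverse B
    (transverse B q.1 - q.2 *: (transverse_damping q.1 *: transverse B q.1))
    (im_mx q.1 - q.2 *: (im_damping q.1 *: im_mx q.1)).

Lemma continuous_retraction : continuous retraction.
Proof.
have cn (f : 'cV[R[i]]_2 -> 'cV[R]_2) : continuous f ->
    continuous (fun z => `|f z|).
  by move=> cf z; exact: (continuous_comp (cf z) (@norm_continuous _ _ _)).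
have ct := @continuous_transverse _ B; have ci := @continuous_im_mx R.
apply: continuous_of_transverse; apply: continuous_damped => //.
  apply: continuous_scale_bounded => // z; first exact: min1_ratio_norm_le1.
  by move=> z0; apply: continuous_min1_ratio; rewrite ?normr_eq0 //; exact: cn.
apply: continuous_scale_bounded => // z; first exact: min1_ratio_norm_le1.
by move=> z0; apply: continuous_min1_ratio; rewrite ?normr_eq0 //; exact: cn.
Qed.

Lemma retraction0 z : retraction (z, 0) = z.
Proof. by rewrite /retraction /= !scale0r !subr0 of_transverseK. Qed.

(** Where one of the two vectors vanishes, the damping factor of the other has numerator 0. *)
Lemma retraction_fix z t : transverse B z = 0 \/ im_mx z = 0 ->
  retraction (z, t) = z.
Proof.
rewrite /retraction /transverse_damping /im_damping /=.
case=> z0; rewrite -[RHS](of_transverseK B) z0 normr0 mul0r (min_r ler01);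
  by rewrite scale0r !scaler0 !subr0.
Qed.

(** By bihomogeneity of [cross], the value is multiplied by two factors in [0, 1]; that of the
    shorter vector is exactly 1 - t. *)
Lemma defining_retraction z t : t \in `[0, 1] ->
  defining (retraction (z, t)) <= (1 - t) * defining z.
Proof.
rewrite in_itv /= => /andP[t0 t1].
have dE : defining (retraction (z, t)) =
    `|(1 - t * transverse_damping z) * (1 - t * im_damping z)| * defining z.
  rewrite /defining /retraction transverse_of_transverse im_of_transverse /=.
  rewrite -crossZ !scalerA -{1}[transverse B z]scale1r -{1}[im_mx z]scale1r.
  by rewrite -!scalerBl -!scalemxAr.
have k01 (a b : R) : 0 <= a -> 0 <= b -> 0 <= 1 - t * Num.min 1 (a / b) <= 1.
  move=> a0 b0.
  have m0 : 0 <= Num.min 1 (a / b) by rewrite le_min ler01 divr_ge0.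
  rewrite subr_ge0 gerBl mulr_ge0 // andbT mulr_ile1 //.
  by rewrite ge_min lexx.
have /andP[k0 k1] := k01 _ _ (normr_ge0 (im_mx z)) (normr_ge0 (transverse B z)).
have /andP[l0 l1] := k01 _ _ (normr_ge0 (transverse B z)) (normr_ge0 (im_mx z)).
(* A zero vector has damping factor 0 instead of 1, so it is treated apart; both sides of the
   inequality are then 0. *)
have [u0|u0] := eqVneq (transverse B z) 0.
  by rewrite dE /defining u0 mulmx0 cross0v !mulr0.
have [v0|v0] := eqVneq (im_mx z) 0.
  by rewrite dE /defining v0 mulmx0 crossv0 !mulr0.
rewrite dE; apply: ler_wpM2r; first exact: defining_ge0.
rewrite ger0_norm ?mulr_ge0 // /transverse_damping /im_damping.
have [uv|vu] := leP `|transverse B z| `|im_mx z|.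
  rewrite (min_l (y := `|im_mx z| / _)); last first.
    by rewrite ler_pdivlMr ?normr_gt0 // mul1r.
  by rewrite mulr1 ler_piMr // subr_ge0.
rewrite (min_l (y := `|transverse B z| / _)); last first.
  by rewrite ler_pdivlMr ?normr_gt0 // mul1r ltW.
by rewrite mulr1 ler_piMl // subr_ge0.
Qed.

Lemma regular_basis_defining : P \in unitmx ->
  regular_basis (M_union B) (fun e : R => [set z | defining z < e]).
Proof.
move=> Pu; rewrite M_unionE //.
apply: (@regular_basis_sublevel _ _ _ retraction).
- exact: continuous_defining.
- exact: continuous_retraction.
- exact: defining_ge0.
- exact: retraction0.
- exact: defining_retraction.
- by move=> z t _ /defining_eq0 => /(_ Pu); exact: retraction_fix.
Qed.

(** * The complex coordinates of w = P z and Steinness of the sublevel sets *)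

Definition coord_form (i : 'I_2) z : R[i] :=
  (P i 0)%:C * z 0 0 + (P i 1)%:C * z 1 0.

Lemma holomorphic_coord_form i : holomorphic_on setT (coord_form i).
Proof.
move=> z _; apply: differentiableD; apply: differentiableM;
  by [exact: differentiable_cst|exact: differentiable_coord].
Qed.

Lemma Im_coord_form i z : complex.Im (coord_form i z) = (P *m im_mx z) i 0.
Proof.
rewrite mulmx2E !mxE /coord_form.
by case: (z 0 0) (z 1 0) => [a b] [c d] /=; ring.
Qed.

Lemma Re_coord_form i z : complex.Re (coord_form i z) = (P *m re_mx z) i 0.
Proof.
rewrite mulmx2E !mxE /coord_form.
by case: (z 0 0) (z 1 0) => [a b] [c d] /=; ring.
Qed.

(** Diagonalizability enters here: each entry of P u, like that of P v, depends on a single complex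
    coordinate w_i. *)
Lemma transverse_coord_form (d : 'rV[R]_2) i z : P *m B = diag_mx d *m P ->
  (P *m transverse B z) i 0 =
  complex.Re (coord_form i z) - d 0 i * complex.Im (coord_form i z).
Proof.
move=> PB; rewrite Re_coord_form Im_coord_form mulmxBr mulmxA PB -mulmxA.
by rewrite mul_diag_mx !mxE.
Qed.

Lemma stein_defining (d : 'rV[R]_2) (e : R) :
  P *m B = diag_mx d *m P -> d 0 0 + d 0 1 = 0 ->
  stein [set z | defining z < e].
Proof.
move=> PB d0; apply: stein_of_avoiding.
  apply: (open_comp (f := defining)) (open_lt (y := e)) => z _.
  exact: continuous_defining.
move=> p /negP; rewrite -leNgt /defining /cross => pe.
pose w i z := coord_form i z.
have tE i z := transverse_coord_form d i z PB.
(* On the line w_i = w_i(p) the i-th product keeps its value at [p], which is at least [e] in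
   absolute value; hence q = w_i - w_i(p) has no zero in the sublevel set. *)
have linear_case i : e <= `|(P *m transverse B p) i 0 * (P *m im_mx p) i 0| ->
    (forall z,
      `|(P *m transverse B z) i 0 * (P *m im_mx z) i 0| <= defining z) ->
    exists q : 'cV[R[i]]_2 -> R[i],
     [/\ holomorphic_on setT q, q p = 0 & forall z, defining z < e -> q z <> 0].
  move=> ep le_def; exists (fun z => w i z - w i p).
  split; [|exact: subrr|].
    move=> z _; apply: differentiableB; first exact: holomorphic_coord_form.
    exact: differentiable_cst.
  move=> z; rewrite ltNge => /negP ze /eqP; rewrite subr_eq0 => /eqP wz.
  apply: ze; apply: le_trans (le_def z).
  by rewrite tE -Im_coord_form -/(w i z) wz -tE Im_coord_form.
(* The choice of [q] follows the term of the maximum that reaches [e] at [p]. *)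
move: pe; rewrite !le_max => /or3P[|/=|/= ep].
- by move/linear_case; apply => z; rewrite /defining /cross le_max lexx.
- by move/linear_case; apply => z; rewrite /defining /cross !le_max lexx orbT.
(* In general the left side is Im(w_0 w_1) - (d_0 + d_1) Im w_0 Im w_1; the last term drops out as
   d_0 + d_1 = 0. *)
have mixed z : (P *m transverse B z) 0 0 * (P *m im_mx z) 1 0 +
    (P *m transverse B z) 1 0 * (P *m im_mx z) 0 0 = complex.Im (w 0 z * w 1 z).
  rewrite !tE -!Im_coord_form -!/(w _ z) (_ : d 0 1 = - d 0 0); last first.
    by apply/eqP; rewrite -addr_eq0 addrC d0.
  by case: (w 0 z) (w 1 z) => [a b] [a' b'] /=; ring.
exists (fun z => w 0 z * w 1 z - w 0 p * w 1 p); split; [|exact: subrr|].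
  move=> z _; apply: differentiableB; last exact: differentiable_cst.
  by apply: differentiableM; exact: holomorphic_coord_form.
move=> z /=; rewrite ltNge => /negP ze /eqP; rewrite subr_eq0 => /eqP wz.
apply: ze; by rewrite !le_max mixed wz -mixed ep !orbT.
Qed.

End Defining.

(** * Diagonalization of B and conclusion *)

Theorem proposition5p4 (R : realType) (B : 'M[R]_2) :
  diagonalizable B -> \tr B = 0 ->
  exists Omega : R -> set 'cV[R[i]]_2,
    regular_basis (M_union B) Omega /\
    (forall e : R, 0 < e < 1 -> stein (Omega e)).
Proof.
move=> [P Pu /diagonalizable_forPex[d]] /(simmxP Pu) PB trB.
have d0 : d 0 0 + d 0 1 = 0.
  (* The trace is invariant under conjugation by [P]. *)
  rewrite -trB -[B](mulKmx Pu) PB mulmxA mxtrace_mulC mulmxA mulmxV // mul1mx.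
  rewrite mxtrace_diag !big_ord_recl big_ord0 addr0 (_ : lift _ _ = 1) //.
  exact: val_inj.
exists (fun e => [set z | defining B P z < e]); split.
  exact: regular_basis_defining.
by move=> e _; exact: (@stein_defining _ B P d).
Qed.
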